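(* Fix $(z,z')$ in the principal or complementary series. As $\xi\to1$ (with $0<\xi<1$), the selfadjoint operators $D_{z,z',\xi}$ converge to the selfadjoint operator $D^{\mathrm{gamma}}_{z,z'}$ in the strong resolvent sense.
   Context: $\mathbb{Z}'=\mathbb{Z}+\tfrac12$ is the lattice of half-integers. $\ell^2_0(\mathbb{Z}')\subset\ell^2(\mathbb{Z}')$ is the dense subspace of finitely supported functions. $(z,z')$ belongs to the principal series if $z,z'\in\mathbb{C}$ are complex conjugate and nonreal; it belongs to the complementary series if $z,z'$ are real and both lie in one and the same open interval $(m,m+1)$ with $m\in\mathbb{Z}$. In both cases $(z+k)(z'+k)>0$ for all $k\in\mathbb{Z}$. For $0<\xi<1$, the difference operators $\mathcal{D}_{z,z',\xi}$ and $\mathcal{D}^{\mathrm{gamma}}_{z,z'}$ act on functions $f$ on $\mathbb{Z}'$ by $$\mathcal{D}_{z,z',\xi}f(x)=\sqrt{\xi(z+x+\tfrac12)(z'+x+\tfrac12)}\,f(x+1)-(x+\xi(z+z'+x))f(x)+\sqrt{\xi(z+x-\tfrac12)(z'+x-\tfrac12)}\,f(x-1),$$ $$\mathcal{D}^{\mathrm{gamma}}_{z,z'}f(x)=\sqrt{(z+x+\tfrac12)(z'+x+\tfrac12)}\,f(x+1)-(z+z'+2x)f(x)+\sqrt{(z+x-\tfrac12)(z'+x-\tfrac12)}\,f(x-1),$$ with positive square roots. Considered as symmetric operators in $\ell^2(\mathbb{Z}')$ with domain $\ell^2_0(\mathbb{Z}')$, both are essentially selfadjoint; $D_{z,z',\xi}$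 and $D^{\mathrm{gamma}}_{z,z'}$ denote their closures. Strong resolvent convergence $A_n\to A$ of selfadjoint operators means that $(A_n-\lambda)^{-1}\to(A-\lambda)^{-1}$ in the strong operator topology for every $\lambda\in\mathbb{C}\setminus\mathbb{R}$. *)

(* Defs.v *)
From mathcomp Require Import all_boot all_order all_algebra.
From mathcomp Require Import complex.
From mathcomp Require Import all_classical all_reals all_analysis.

Set Implicit Arguments.
Unset Strict Implicit.
Unset Printing Implicit Defensive.

Import Order.TTheory GRing.Theory Num.Theory.
Import numFieldNormedType.Exports.

Local Open Scope classical_set_scope.
Local Open Scope ring_scope.
Local Open Scope complex_scope.

(* The half-integer lattice Z' = Z + 1/2 is indexed by int: the index n stands
   for the point x = n + 1/2, and n + 1, n - 1 for x + 1, x - 1. *)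
Definition half_integer (R : realType) (n : int) : R[i] := n%:~R + 2^-1.

(* A complex function on Z'. *)
Notation zfun R := (int -> R[i]).

Section HilbertSpace.
Context {R : realType}.
Implicit Types f g : zfun R.

Definition l2norm f : \bar R :=
  sqrte (\esum_(n in [set: int]) (complex.Re `|f n| ^+ 2)%:E).

Definition l2 : set (zfun R) := [set f | (l2norm f < +oo)%E].

Definition l2_0 : set (zfun R) := [set f | finite_set [set n | f n != 0]].

(* Linear in the first argument.  For f, g in l2 the series converges
   absolutely, so that the order of summation 0, -1, 1, -2, ... is
   immaterial; Posz k is k and Negz k is - k - 1. *)
Definition l2inner f g : R[i] :=
  limn ((fun N => \sum_(k < N)
    (f (Posz k) * (g (Posz k))^* + f (Negz k) * (g (Negz k))^*)) : nat -> R[i]^o).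

End HilbertSpace.

(* A (possibly unbounded, partially defined) operator is represented by its
   graph: A (f, g) means that f is in the domain of A and A f = g. *)
Notation operator R := (set (zfun R * zfun R)%type).

Section Operators.
Context {R : realType}.
Implicit Types (A B : operator R) (f g h : zfun R) (lambda : R[i]).

Definition domain A : set (zfun R) := [set f | exists g, A (f, g)].

Definition op_closure A : operator R :=
  [set p | [/\ l2 p.1, l2 p.2 & forall e : R, 0 < e ->
     exists2 q, A q & (l2norm (fun n => (p.1 n - q.1 n)%R) < e%:E)%E /\
                      (l2norm (fun n => (p.2 n - q.2 n)%R) < e%:E)%E]].

Definition densely_defined A :=
  forall g, l2 g -> forall e : R, 0 < e ->
    exists2 f, domain A f & (l2norm (fun n => (g n - f n)%R) < e%:E)%E.

Definition adjoint A : operator R :=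
  [set p | [/\ l2 p.1, l2 p.2 &
     forall q, A q -> l2inner q.2 p.1 = l2inner q.1 p.2]].

Definition selfadjoint A := densely_defined A /\ A = adjoint A.

Definition op_shift A lambda : operator R :=
  [set p | exists2 g, A (p.1, g) & p.2 = (fun n => g n - lambda * p.1 n)].

Definition op_inv A : operator R := [set p | A (p.2, p.1)].

Definition resolvent A lambda : operator R := op_inv (op_shift A lambda).

(* The value A f; it is the zero function when f is not in the domain. *)
Definition op_app A f : zfun R := xget (fun=> 0) [set g | A (f, g)].

Definition strong_cvg (T : Type) (F : set_system T) (A : T -> operator R) B :=
  forall g, l2 g ->
    l2norm (fun n => op_app (A t) g n - op_app B g n) @[t --> F] --> (0 : \bar R).

(* To be used for selfadjoint operators: then the resolvents at nonreal lambda
   are bounded operators defined on the whole of l2. *)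
Definition strong_resolvent_cvg (T : Type) (F : set_system T)
    (A : T -> operator R) B :=
  forall lambda, lambda \isn't Num.real ->
    strong_cvg F (fun t => resolvent (A t) lambda) (resolvent B lambda).

(* The operator with domain l2_0 acting by the expression L. *)
Definition minimal_operator (L : zfun R -> zfun R) : operator R :=
  [set p | l2_0 p.1 /\ p.2 = L p.1].

End Operators.

Section DifferenceOperators.
Context {R : realType}.
Implicit Types (xi : R) (f : zfun R).

Definition principal_series (z z' : R[i]) := z' = z^* /\ z \isn't Num.real.

Definition complementary_series (z z' : R[i]) :=
  [/\ z \is Num.real, z' \is Num.real & exists m : int,
     (m%:~R < z < (m + 1)%:~R) && (m%:~R < z' < (m + 1)%:~R)].

(* sqrtC is the nonnegative square root on nonnegative arguments, and all the
   radicands below are positive for (z, z') in the two series. *)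
Definition diff_op (z z' : R[i]) xi f : zfun R := fun n =>
  let x := half_integer R n in
  sqrtC (xi%:C * (z + x + 2^-1) * (z' + x + 2^-1)) * f (n + 1)
  - (x + xi%:C * (z + z' + x)) * f n
  + sqrtC (xi%:C * (z + x - 2^-1) * (z' + x - 2^-1)) * f (n - 1).

Definition diff_op_gamma (z z' : R[i]) f : zfun R := fun n =>
  let x := half_integer R n in
  sqrtC ((z + x + 2^-1) * (z' + x + 2^-1)) * f (n + 1)
  - (z + z' + 2 * x) * f n
  + sqrtC ((z + x - 2^-1) * (z' + x - 2^-1)) * f (n - 1).

Definition D (z z' : R[i]) xi : operator R :=
  op_closure (minimal_operator (diff_op z z' xi)).

Definition D_gamma (z z' : R[i]) : operator R :=
  op_closure (minimal_operator (diff_op_gamma z z')).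

End DifferenceOperators.

(* Main.v *)
Require Import Defs.
From mathcomp Require Import all_boot all_order all_algebra.
From mathcomp Require Import complex.
From mathcomp Require Import all_classical all_reals all_analysis.
From mathcomp Require Import ring lra zify.
Import Order.TTheory GRing.Theory Num.Theory.
Import numFieldNormedType.Exports.
Local Open Scope classical_set_scope.
Local Open Scope ring_scope.

Set Implicit Arguments.
Unset Strict Implicit.
Unset Printing Implicit Defensive.

(** Both operators are Jacobi operators on the integers: with real sequences
    [a], [b], they act by
    [(J f) n = a n * f (n + 1) - b n * f n + a (n - 1) * f (n - 1)], and
    [D_gamma z z'] is the member [xi = 1] of the family [D z z' xi].  What
    matters about the coefficients is that [a] grows at most linearly and that
    they depend continuously on [xi].

    Linear growth makes a trapezoidal cutoff of width [N] almost commute with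
    [J]: its slope is of order [1 / N], while [a] is of order [N] on its
    support, so that the commutator is bounded and lives far from the origin.
    Hence every [f] with [f] and [J f] square summable is a limit of finitely
    supported sequences in the graph norm ([jac_approx]); in other words the
    closure of the minimal operator is the maximal one ([closure_jac]).
    Green's identity, exact for finitely supported sequences, extends by this
    density to the maximal domain and gives selfadjointness ([adjoint_jac],
    [selfadjoint_jac]).

    For nonreal [lam] the same identity bounds [f] by [(J - lam) f]
    ([resolvent_window], [resolvent_bound]).  The equation [(J - lam) f = g] is
    solved on the intervals from [- N] to [N - 1], where the bound makes a
    square linear system injective, and a pointwise limit of these solutions
    along an ultrafilter solves it on the whole line ([resolvent_exists]).

    Strong resolvent convergence follows as usual from convergence on a common
    core ([strong_resolvent_jac]).  Let [f] solve the limiting equation and let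
    [phi] be finitely supported and close to [f] in the graph norm of the limit
    [J].  When the coefficients of [J_t] are close to those of [J],
    [(J_t - lam) phi] is close to [(J - lam) phi], hence to [g]; the resolvent
    bound for [J_t] then puts [phi] close to the solution of
    [(J_t - lam) f_t = g], so that [f_t] is close to [f].

    All estimates are made on squared norms, through the partial sums [wsum],
    with [nsqD_le] in the role of the triangle inequality; the constants that
    this costs are harmless, since every estimate is used with an arbitrarily
    small right-hand side. *)

(** * Symmetric partial sums *)

Section PartialSums.
Context {V : comNzRingType}.
Implicit Types (F G : int -> V) (N : nat).

Definition wsum N F : V := \sum_(k < N) (F (Posz k) + F (Negz k)).

Definition win N (n : int) : bool := - N%:Z <= n < N%:Z.

Lemma winNegz N k : win N (Negz k) = (k < N)%N.
Proof. by rewrite /win; lia. Qed.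

Lemma winPosz N k : win N (Posz k) = (k < N)%N.
Proof. by rewrite /win; lia. Qed.

Lemma wsumS N F : wsum N.+1 F = wsum N F + (F (Posz N) + F (Negz N)).
Proof. by rewrite /wsum big_ord_recr. Qed.

Lemma eq_wsum_win N F G :
  (forall n, win N n -> F n = G n) -> wsum N F = wsum N G.
Proof.
by move=> FG; apply: eq_bigr => k _; rewrite !FG ?winNegz ?winPosz.
Qed.

Lemma eq_wsum N F G : (forall n, F n = G n) -> wsum N F = wsum N G.
Proof. by move=> FG; apply: eq_wsum_win. Qed.

Lemma wsumD N F G : wsum N (fun n => F n + G n) = wsum N F + wsum N G.
Proof. by rewrite /wsum -big_split /=; apply: eq_bigr => k _; rewrite addrACA. Qed.

Lemma wsumZ N c F : wsum N (fun n => c * F n) = c * wsum N F.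
Proof. by rewrite /wsum mulr_sumr; apply: eq_bigr => k _; rewrite mulrDr. Qed.

Lemma wsumB N F G : wsum N (fun n => F n - G n) = wsum N F - wsum N G.
Proof.
by rewrite -[- wsum _ _]mulN1r -wsumZ -wsumD; apply: eq_wsum => n; rewrite mulN1r.
Qed.

(** Seen on the line of integers, the terms of [wsum N] fill the interval from
    [- N] to [N - 1]; shifting the summand by one only moves the end terms. *)
Lemma wsum_shift N F :
  wsum N (fun n => F (n + 1)) = wsum N F + F N%:Z - F (- N%:Z).
Proof.
elim: N => [|N IH]; first by rewrite /wsum !big_ord0 oppr0 add0r subrr.
rewrite !wsumS IH !NegzE.
have -> : N%:Z + 1 = N.+1%:Z by lia.
have -> : - N.+1%:Z + 1 = - N%:Z by lia.
by ring.
Qed.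

Lemma wsum_telescope N F :
  wsum N (fun n => F n - F (n - 1)) = F (N%:Z - 1) - F (- N%:Z - 1).
Proof.
have := wsum_shift N (fun n => F (n - 1)) => /=.
under eq_wsum do rewrite addrK.
by move=> E; rewrite wsumB E; ring.
Qed.

End PartialSums.

(** * Complex numbers and square sums *)

Section SquareSums.
Context {R : realType}.
Implicit Types (x y : R[i]) (f g : zfun R) (F G : int -> R) (A B C : R).
Implicit Types (N : nat).

Lemma complexRe0 : complex.Re (0 : R[i]) = 0. Proof. by []. Qed.
Lemma complexIm0 : complex.Im (0 : R[i]) = 0. Proof. by []. Qed.

Lemma complexReD x y : complex.Re (x + y) = complex.Re x + complex.Re y.
Proof. by case: x y => ? ? []. Qed.

Lemma complexImD x y : complex.Im (x + y) = complex.Im x + complex.Im y.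
Proof. by case: x y => ? ? []. Qed.

Lemma complexReN x : complex.Re (- x) = - complex.Re x.
Proof. by case: x. Qed.

Lemma complexImN x : complex.Im (- x) = - complex.Im x.
Proof. by case: x. Qed.

Lemma complexReM x y :
  complex.Re (x * y) =
    complex.Re x * complex.Re y - complex.Im x * complex.Im y.
Proof. by case: x y => ? ? []. Qed.

Lemma complexImM x y :
  complex.Im (x * y) =
    complex.Re x * complex.Im y + complex.Im x * complex.Re y.
Proof. by case: x y => ? ? []. Qed.

Lemma complexReJ x : complex.Re (x^*) = complex.Re x.
Proof. by case: x. Qed.

Lemma complexImJ x : complex.Im (x^*) = - complex.Im x.
Proof. by case: x. Qed.

Lemma complexReC (r : R) : complex.Re (r%:C)%C = r. Proof. by []. Qed.
Lemma complexImC (r : R) : complex.Im (r%:C)%C = 0. Proof. by []. Qed.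

Definition complexReIm := (complexReD, complexImD, complexReN, complexImN,
  complexReM, complexImM, complexReJ, complexImJ, complexReC, complexImC,
  complexRe0, complexIm0).

Lemma complex_eqP x y :
  complex.Re x = complex.Re y -> complex.Im x = complex.Im y -> x = y.
Proof. by case: x y => ? ? [? ?] /= -> ->. Qed.

Definition nsq x : R := complex.Re x ^+ 2 + complex.Im x ^+ 2.

Lemma nsqE x : complex.Re `|x| ^+ 2 = nsq x.
Proof. by rewrite normc_def /= sqr_sqrtr // addr_ge0 ?sqr_ge0. Qed.

Lemma nsq_ge0 x : 0 <= nsq x.
Proof. by rewrite addr_ge0 ?sqr_ge0. Qed.

Lemma nsq0 : nsq 0 = 0.
Proof. by rewrite /nsq /= expr0n addr0. Qed.

Lemma nsq_eq0 x : nsq x = 0 -> x = 0.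
Proof.
move/eqP; rewrite paddr_eq0 ?sqr_ge0 // !sqrf_eq0 => /andP[/eqP a /eqP b].
exact: complex_eqP.
Qed.

Lemma nsqM x y : nsq (x * y) = nsq x * nsq y.
Proof. by rewrite /nsq !complexReIm; ring. Qed.

Lemma nsqN x : nsq (- x) = nsq x.
Proof. by rewrite /nsq !complexReIm !sqrrN. Qed.

Lemma nsqC (r : R) : nsq (r%:C)%C = r ^+ 2.
Proof. by rewrite /nsq /= expr0n addr0. Qed.

(** This replaces the triangle inequality: it keeps the bounds polynomial, at
    the price of a factor 2. *)
Lemma nsqD_le x y : nsq (x + y) <= 2 * nsq x + 2 * nsq y.
Proof.
rewrite /nsq !complexReIm.
have := sqr_ge0 (complex.Re x - complex.Re y).
have := sqr_ge0 (complex.Im x - complex.Im y); lra.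
Qed.

Lemma wsum_ge0 N F : (forall n, 0 <= F n) -> 0 <= wsum N F.
Proof. by move=> F0; apply: sumr_ge0 => k _; rewrite addr_ge0. Qed.

Lemma ler_wsum N F G : (forall n, F n <= G n) -> wsum N F <= wsum N G.
Proof. by move=> FG; apply: ler_sum => k _; rewrite lerD. Qed.

Lemma ler_wsumn M N F : (forall n, 0 <= F n) -> (M <= N)%N ->
  wsum M F <= wsum N F.
Proof.
move=> F0 /subnK <-; elim: (N - M)%N => [//|k IH].
by rewrite addSn wsumS (le_trans IH) // lerDl addr_ge0.
Qed.

Lemma wsum_ge_term N F n : (forall n, 0 <= F n) -> win N n -> F n <= wsum N F.
Proof.
move=> F0; case: n => n; rewrite ?winPosz ?winNegz => lt_nN;
  apply: (le_trans _ (ler_wsumn F0 lt_nN)); rewrite wsumS.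
- by rewrite addrCA lerDl addr_ge0 // wsum_ge0.
- by rewrite addrA lerDr addr_ge0 // wsum_ge0.
Qed.

Lemma win_absz n : win `|n|.+1 n.
Proof. by rewrite /win; lia. Qed.

(** [sqle f C] is the bound of the squared norm of [f] by [C], phrased on finite
    sums so that estimates never meet extended reals. *)
Definition sqle f C := forall N, wsum N (nsq \o f) <= C.

Lemma sqle_ge0 f C : sqle f C -> 0 <= C.
Proof. by move=> /(_ 0%N); rewrite /wsum big_ord0. Qed.

Lemma sqle_term f C n : sqle f C -> nsq (f n) <= C.
Proof.
move=> /(_ `|n|.+1); apply: le_trans.
apply: (@wsum_ge_term _ (nsq \o f)); last exact: win_absz.
by move=> k; exact: nsq_ge0.
Qed.

Lemma sqle_trans f A B : sqle f A -> A <= B -> sqle f B.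
Proof. by move=> fA AB N; exact: le_trans (fA N) AB. Qed.

Lemma sqle_dom f g A C : 0 <= C -> (forall n, nsq (f n) <= C * nsq (g n)) ->
  sqle g A -> sqle f (C * A).
Proof.
move=> C0 fg gA N; apply: (le_trans _ (ler_wpM2l C0 (gA N))).
by rewrite -wsumZ; exact: ler_wsum.
Qed.

Lemma eq_sqle f g A : (forall n, f n = g n) -> sqle g A -> sqle f A.
Proof. by move=> /funext ->. Qed.

Lemma sqleD f g A B : sqle f A -> sqle g B ->
  sqle (fun n => f n + g n) (2 * A + 2 * B).
Proof.
move=> fA gB N.
apply: (@le_trans _ _ (2 * wsum N (nsq \o f) + 2 * wsum N (nsq \o g))).
  by rewrite -!wsumZ -wsumD; apply: ler_wsum => n; exact: nsqD_le.
by rewrite lerD // ler_wpM2l.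
Qed.

Lemma sqleN f A : sqle f A -> sqle (fun n => - f n) A.
Proof.
by move=> fA N; rewrite (@eq_wsum _ _ _ (nsq \o f)) // => n /=; rewrite nsqN.
Qed.

Lemma sqleB f g A B : sqle f A -> sqle g B ->
  sqle (fun n => f n - g n) (2 * A + 2 * B).
Proof. by move=> fA gB; exact: sqleD fA (sqleN gB). Qed.

Lemma sqleZ (c : R[i]) f A : sqle f A -> sqle (fun n => c * f n) (nsq c * A).
Proof.
by apply: sqle_dom => [|n]; [exact: nsq_ge0|rewrite nsqM].
Qed.

Lemma sqle_succ f A : sqle f A -> sqle (fun n => f (n + 1)) A.
Proof.
move=> fA N; apply: (le_trans _ (fA N.+1)).
rewrite (wsum_shift N (nsq \o f)) wsumS -addrA lerD2l /=.
by have := nsq_ge0 (f (- N%:Z)); have := nsq_ge0 (f (Negz N)); lra.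
Qed.

Lemma sqle_pred f A : sqle f A -> sqle (fun n => f (n - 1)) A.
Proof.
move=> fA N; apply: (le_trans _ (fA N.+1)).
have := wsum_shift N (fun n => nsq (f (n - 1))).
under eq_wsum do rewrite addrK.
rewrite wsumS /= => ->; rewrite /comp NegzE.
have -> : - N.+1%:Z = - N%:Z - 1 by lia.
by have := nsq_ge0 (f (N%:Z - 1)); have := nsq_ge0 (f N%:Z); lra.
Qed.

End SquareSums.

(** * The norm of square summable sequences *)

Section NormBridge.
Context {R : realType}.
Implicit Types (f g : zfun R) (F : int -> R) (C e : R).

Lemma esum_int (F : int -> R) : (forall n, 0 <= F n) ->
  \esum_(n in [set: int]) (F n)%:E =
  (\sum_(0 <= k <oo) (F (Posz k) + F (Negz k))%:E)%E.
Proof.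
move=> F0; rewrite (esumID (range Posz)); last by move=> n _; rewrite lee_fin.
have -> : [set: int] `&` range Posz = Posz @` [set: nat] by rewrite setTI.
have -> : [set: int] `&` ~` range Posz = Negz @` [set: nat].
  rewrite setTI; apply/seteqP; split=> [[n|n] /=|_ [n _ <-] [m _]] //.
  - by move=> []; exists n.
  - by exists n.
rewrite !esum_image; first last.
- by move=> m n _ _ [].
- by move=> m n _ _ [].
by rewrite -!nneseries_esumT -?nneseriesD // => *; rewrite lee_fin.
Qed.

Lemma esum_int_leP F C : (forall n, 0 <= F n) ->
  (\esum_(n in [set: int]) (F n)%:E <= C%:E)%E <-> forall N, wsum N F <= C.
Proof.
move=> F0; rewrite esum_int //.
have psum N : (\sum_(0 <= k < N) (F (Posz k) + F (Negz k))%:E)%E =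
    (wsum N F)%:E by rewrite big_mkord sumEFin.
have F20 (k : nat) : (0 <= (F (Posz k) + F (Negz k))%:E)%E.
  by rewrite lee_fin addr_ge0.
split=> [le_C N|le_C].
  rewrite -lee_fin -psum; apply: le_trans le_C.
  exact: nneseries_lim_ge.
apply: lime_le; first exact: is_cvg_nneseries.
by apply: nearW => N; rewrite psum lee_fin.
Qed.

(** Through this bridge every statement about the norm becomes one about finite
    sums. *)
Lemma l2norm_leP f C : 0 <= C ->
  (l2norm f <= (Num.sqrt C)%:E)%E <-> sqle f C.
Proof.
move=> C0; rewrite /l2norm.
have -> : (Num.sqrt C)%:E = sqrte C%:E by [].
rewrite lee_sqrt ?lee_fin //.
have -> : (fun n => (complex.Re `|f n| ^+ 2)%:E) = (fun n => (nsq (f n))%:E).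
  by apply/funext => n; rewrite nsqE.
exact: (@esum_int_leP (nsq \o f) C (fun n => nsq_ge0 (f n))).
Qed.

Lemma l2norm_ge0 f : (0 <= l2norm f)%E.
Proof. exact: sqrte_ge0. Qed.

Lemma l2P f : l2 f <-> exists C, sqle f C.
Proof.
split=> [|[C fC]]; last first.
  apply: (@le_lt_trans _ _ (Num.sqrt C)%:E); last exact: ltry.
  by apply/l2norm_leP => //; exact: sqle_ge0 fC.
rewrite /l2 /=; have := l2norm_ge0 f; case E : (l2norm f) => [r| |] // r0 _.
exists (r ^+ 2); apply/l2norm_leP; first exact: sqr_ge0.
by rewrite sqrtr_sqr E lee_fin ler_norm.
Qed.

Lemma l2norm_lt_sqle f e : (l2norm f < e%:E)%E -> sqle f (e ^+ 2).
Proof.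
move=> fe; apply/l2norm_leP; first exact: sqr_ge0.
by rewrite sqrtr_sqr (le_trans (ltW fe)) // lee_fin ler_norm.
Qed.

Lemma sqle_l2norm_lt f e : 0 < e -> sqle f ((e / 2) ^+ 2) ->
  (l2norm f < e%:E)%E.
Proof.
move=> e0 /l2norm_leP => /(_ (sqr_ge0 _)) fe; apply: le_lt_trans fe _.
by rewrite sqrtr_sqr lte_fin ger0_norm; lra.
Qed.

End NormBridge.

(** * Jacobi operators *)

Section Jacobi.
Context {R : realType}.
Implicit Types (a b : int -> R) (f g v : zfun R) (lam : R[i]).

Definition jac a b f : zfun R := fun n =>
  (a n)%:C%C * f (n + 1) - (b n)%:C%C * f n + (a (n - 1))%:C%C * f (n - 1).

Lemma jacB a b f g n :
  jac a b (fun n => f n - g n) n = jac a b f n - jac a b g n.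
Proof. by rewrite /jac; ring. Qed.

(** The boundary term of summation by parts, the discrete Wronskian of [f] and
    the conjugate of [g]. *)
Definition casoratian a f g : zfun R := fun n =>
  (a n)%:C%C * (f (n + 1) * (g n)^* - f n * (g (n + 1))^*).

Lemma green_term a b f g n :
  jac a b f n * (g n)^* - f n * (jac a b g n)^* =
    casoratian a f g n - casoratian a f g (n - 1).
Proof.
rewrite /jac /casoratian subrK.
by apply: complex_eqP; rewrite !complexReIm; ring.
Qed.

Lemma green a b f g N :
  wsum N (fun n => jac a b f n * (g n)^* - f n * (jac a b g n)^*) =
    casoratian a f g (N%:Z - 1) - casoratian a f g (- N%:Z - 1).
Proof. by rewrite -wsum_telescope; apply: eq_wsum => n; rewrite green_term. Qed.

Lemma green0 a b f g N : f N%:Z = 0 -> f (N%:Z - 1) = 0 ->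
  f (- N%:Z) = 0 -> f (- N%:Z - 1) = 0 ->
  wsum N (fun n => jac a b f n * (g n)^* - f n * (jac a b g n)^*) = 0.
Proof.
by move=> f1 f2 f3 f4; rewrite green /casoratian !subrK f1 f2 f3 f4; ring.
Qed.

Lemma resolvent_term a b v lam n :
  nsq (jac a b v n - lam * v n) =
    nsq (jac a b v n - (complex.Re lam)%:C%C * v n)
    + complex.Im lam ^+ 2 * nsq (v n)
    - complex.Im lam * complex.Im (casoratian a v v n - casoratian a v v (n - 1)).
Proof.
rewrite -(green_term a b); move: (jac a b v n) => u.
by rewrite /nsq !complexReIm; ring.
Qed.

(** With [lam = rho + i mu], the cross term in the expansion of
    [|(J - rho) v - i mu v|^2] is [mu] times the imaginary part of
    [J v * v^*], which is a difference of Casoratians and telescopes to 0 when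
    [v] vanishes next to the window; the remaining terms are nonnegative. *)
Lemma resolvent_window a b v lam N : v N%:Z = 0 -> v (- N%:Z - 1) = 0 ->
  complex.Im lam ^+ 2 * wsum N (nsq \o v)
    <= wsum N (fun n => nsq (jac a b v n - lam * v n)).
Proof.
move=> v1 v2; rewrite (eq_wsum _ (resolvent_term a b v lam)).
have E : wsum N (fun n => complex.Im (casoratian a v v n)
                   - complex.Im (casoratian a v v (n - 1))) = 0.
  rewrite (wsum_telescope _ (fun n => complex.Im (casoratian a v v n))).
  rewrite /casoratian !subrK v1 v2.
  by rewrite conjC0 !(mulr0, mul0r, subr0).
rewrite wsumB [X in X - _]wsumD [X in _ - X]wsumZ -[X in X <= _]wsumZ.
under [X in _ - _ * X]eq_wsum do rewrite complexImD complexImN.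
rewrite E mulr0 subr0. rewrite lerDr; apply: wsum_ge0 => n; exact: nsq_ge0.
Qed.

Lemma l2_0P f : l2_0 f <-> exists M, forall n, ~~ win M n -> f n = 0.
Proof.
split=> [/finite_seqP[s sE]|[M fM]].
  exists (\max_(n <- s) `|n|.+1)%N => n nM; apply/eqP; apply: contraNT nM => fn0.
  have : [set` s] n by rewrite -sE.
  move=> /= ns; have : (`|n|.+1 <= \max_(n <- s) `|n|.+1)%N.
    exact: (@leq_bigmax_seq _ _ predT (fun n : int => `|n|.+1)).
  by move: (\max_(n <- s) _)%N => m; rewrite /win; lia.
apply: (@sub_finite_set _ _ [set n : int | win M n]).
  by move=> n /= /eqP fn0; apply: contra_notT fn0; exact: fM.
apply: (@sub_finite_set _ _ ((fun k : nat => k%:Z - M%:Z) @` `I_(M + M))).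
  move=> n /= wn; exists (absz (n + M%:Z)) => /=; move: wn; rewrite /win; lia.
exact/finite_image/finite_II.
Qed.

Lemma sqle_supported M f : (forall n, ~~ win M n -> f n = 0) ->
  sqle f (wsum M (nsq \o f)).
Proof.
move=> fM N; apply: (@le_trans _ _ (wsum (maxn M N) (nsq \o f))).
  by apply: ler_wsumn (leq_maxr _ _) => n; exact: nsq_ge0.
have [k ->] : exists k, maxn M N = (k + M)%N by exists (maxn M N - M)%N; lia.
elim: k => [//|k IH]; rewrite addSn wsumS /= !fM ?winPosz ?winNegz ?nsq0 ?addr0 //; lia.
Qed.

Lemma l2_0_sqle f : l2_0 f -> exists C, sqle f C.
Proof. by move=> /l2_0P[M fM]; exists (wsum M (nsq \o f)); exact: sqle_supported. Qed.

Lemma l2_0_jac a b f : l2_0 f -> l2_0 (jac a b f).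
Proof.
move=> /l2_0P[M fM]; apply/l2_0P; exists M.+1 => n nM.
by rewrite /jac !fM ?(mulr0, subr0, addr0) //; move: nM; rewrite /win; lia.
Qed.

Lemma l2_0_resolvent a b f lam C : complex.Im lam != 0 -> l2_0 f ->
  sqle (fun n => jac a b f n - lam * f n) C ->
  sqle f (C / complex.Im lam ^+ 2).
Proof.
move=> mu0 /l2_0P[M fM] fC N; set K := maxn N M.+1.
apply: (@le_trans _ _ (wsum K (nsq \o f))).
  by apply: ler_wsumn (leq_maxl _ _) => n; exact: nsq_ge0.
rewrite ler_pdivlMr ?exprn_even_gt0 // mulrC; apply: (le_trans _ (fC K)).
by apply: resolvent_window; apply: fM; rewrite /win /K; lia.
Qed.

End Jacobi.

(** * Approximation by finitely supported sequences *)

Section Cutoff.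
Context {R : realType}.
Implicit Types (a b : int -> R) (f g v : zfun R) (lam : R[i]) (C K e : R).

Definition tail N f : zfun R := fun n => if win N n then 0 else f n.

(** The partial sums increase to their supremum, so that one of them is within
    [e] of it and dominates all that lies outside its window. *)
Lemma tail_sqle f C e : sqle f C -> 0 < e ->
  exists M, forall N, (M <= N)%N -> sqle (tail N f) e.
Proof.
move=> fC e0; pose S := [set wsum N (nsq \o f) | N in [set: nat]].
have supS : has_sup S.
  split; first by exists (wsum 0 (nsq \o f)); exists 0%N.
  by exists C => _ [N _ <-]; exact: fC.
have [_ [M _ <-] hM] := sup_adherent e0 supS.
exists M => N MN k; set L := maxn k N.
have F0 n : 0 <= (nsq \o f) n by exact: nsq_ge0.
have T0 n : 0 <= (nsq \o tail N f) n by exact: nsq_ge0.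
have split_tail : wsum L (nsq \o tail N f) + wsum N (nsq \o f) = wsum L (nsq \o f).
  have [j ->] : exists j, L = (j + N)%N by exists (L - N)%N; lia.
  elim: j => [|j IH].
    rewrite add0n [X in X + _](_ : _ = 0) ?add0r //.
    rewrite -[RHS](mul0r (wsum N (fun=> 0))) -wsumZ; apply: eq_wsum_win => n wn.
    by rewrite /= /tail wn nsq0 mul0r.
  rewrite addSn !wsumS -IH /= /tail winPosz winNegz.
  by rewrite ltnNge leq_addl /=; ring.
have : wsum L (nsq \o f) <= sup S.
  by apply: sup_upper_bound => //; exists L.
have : wsum M (nsq \o f) <= wsum N (nsq \o f) by exact: ler_wsumn.
have : wsum k (nsq \o tail N f) <= wsum L (nsq \o tail N f).
  by apply: ler_wsumn (leq_maxl _ _).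
by lra.
Qed.

(** A trapezoid: 1 up to [|n| = N], then affine down to 0 at [|n| = 2 N].  The
    subtractions are truncated, which makes it vanish further out. *)
Definition cutoff N (n : int) : R := (minn N (N + N - `|n|))%N%:R / N%:R.

Lemma cutoff_in N n : (0 < N)%N -> (`|n| <= N)%N -> cutoff N n = 1.
Proof.
move=> N0 nN; rewrite /cutoff.
have -> : minn N (N + N - `|n|) = N by lia.
by rewrite divff // pnatr_eq0; lia.
Qed.

Lemma cutoff_out N n : (N + N <= `|n|)%N -> cutoff N n = 0.
Proof.
move=> nN; rewrite /cutoff.
have -> : minn N (N + N - `|n|) = 0%N by lia.
by rewrite mul0r.
Qed.

Lemma cutoff_ge0 N n : 0 <= cutoff N n.
Proof. by rewrite /cutoff divr_ge0. Qed.

Lemma cutoff_le1 N n : cutoff N n <= 1.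
Proof.
rewrite /cutoff; have [->|N0] := posnP N; first by rewrite invr0 mulr0.
by rewrite ler_pdivrMr ?ltr0n // mul1r ler_nat geq_minl.
Qed.

Lemma cutoff_slope N n : `|cutoff N (n + 1) - cutoff N n| <= N%:R^-1.
Proof.
rewrite /cutoff -mulrBl normrM [`|_^-1|]ger0_norm ?invr_ge0 //.
rewrite ler_piMl ?invr_ge0 // ler_norml.
set p := minn _ _; set q := minn _ _.
have pq : (p <= q + 1)%N by rewrite /p /q; lia.
have qp : (q <= p + 1)%N by rewrite /p /q; lia.
move: pq qp; rewrite -!(ler_nat R) !natrD => ? ?; apply/andP; split; lra.
Qed.

Definition linear_growth a K :=
  forall n : int, `|a n| <= K * (`|n|%N%:R + 1).

(** This is where linear growth enters: the slope is at most [1 / N], and it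
    is nonzero only for [N <= |n| <= 2 N], where [a] is at most
    [K * (2 N + 1) <= 3 K N]. *)
Lemma cutoff_commutator a K N n : linear_growth a K -> (0 < N)%N ->
  `|a n * (cutoff N (n + 1) - cutoff N n)| <= if win N n then 0 else 3 * K.
Proof.
move=> aK N0; have K0 : 0 <= K.
  by have := le_trans (normr_ge0 _) (aK 0); rewrite absz0 add0r mulr1.
case: ifPn => wn.
  by rewrite !cutoff_in ?subrr ?mulr0 ?normr0 //; move: wn; rewrite /win; lia.
have [small|big] := leqP `|n| (N + N); last first.
  have out1 : cutoff N (n + 1) = 0 by apply: cutoff_out; lia.
  have out0 : cutoff N n = 0 by apply: cutoff_out; lia.
  by rewrite out1 out0 subrr mulr0 normr0 mulr_ge0.
rewrite normrM; apply: (@le_trans _ _ (K * (`|n|%N%:R + 1) * N%:R^-1)).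
  by apply: ler_pM => //; exact: cutoff_slope.
rewrite ler_pdivrMr ?ltr0n // [3 * K]mulrC -mulrA ler_wpM2l //.
have : (`|n| + 1 <= 3 * N)%N by lia.
by rewrite -(ler_nat R) natrD natrM.
Qed.

Lemma nsq_le_real (r s : R) x : `|r| <= s -> nsq (r%:C%C * x) <= s ^+ 2 * nsq x.
Proof.
move=> rs; rewrite nsqM nsqC ler_wpM2r ?nsq_ge0 //.
by rewrite -real_normK ?num_real // lerXn2r ?nnegrE // (le_trans _ rs).
Qed.

(** The approximation is the product of [f] with a cutoff.  The error in [f]
    and the three terms of the error in [J f] (one from multiplication by the
    cutoff, two from the commutator) are bounded by tails of [f] and [J f]. *)
Lemma jac_approx a b K f C1 C2 e : linear_growth a K ->
  sqle f C1 -> sqle (jac a b f) C2 -> 0 < e ->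
  exists2 phi, l2_0 phi & sqle (fun n => f n - phi n) e /\
    sqle (fun n => jac a b f n - jac a b phi n) e.
Proof.
move=> aK fC1 fC2 e0; pose c := 9 * K ^+ 2.
have c0 : 0 <= c by rewrite mulr_ge0 ?sqr_ge0.
(* The three errors [d], [c * d], [c * d] add up, through two uses of [nsqD_le],
   to [4 * d + 6 * c * d]. *)
pose d := e / (4 + 6 * c).
have d0 : 0 < d by rewrite divr_gt0 //; lra.
have dE : (4 + 6 * c) * d = e by rewrite mulrC divfK //; lra.
have [M1 h1] := tail_sqle fC1 d0; have [M2 h2] := tail_sqle fC2 d0.
(* The term [f (n + 1)] is read one step closer to the origin, hence the margin
   above the thresholds. *)
pose N := (maxn M1 M2).+2.
have N0 : (0 < N)%N by [].
pose phi : zfun R := fun n => (cutoff N n)%:C%C * f n.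
have near_f g n : nsq (g n - (cutoff N n)%:C%C * g n) <= 1 * nsq (tail N g n).
  have -> : g n - (cutoff N n)%:C%C * g n = (1 - cutoff N n)%:C%C * g n.
    by apply: complex_eqP; rewrite !complexReIm; ring.
  rewrite /tail; case: ifPn => wn.
    rewrite cutoff_in ?subrr ?mul0r ?nsq0 ?mulr0 //.
    by move: wn; rewrite /win; lia.
  rewrite -(expr1n _ 2); apply: nsq_le_real.
  have := cutoff_ge0 N n; have := cutoff_le1 N n => ? ?.
  by rewrite ger0_norm; lra.
exists phi.
  by apply/l2_0P; exists (N + N)%N => n wn; rewrite /phi cutoff_out ?mul0r //;
  move: wn; rewrite /win; lia.
split.
  apply: sqle_trans (sqle_dom ler01 (near_f f) (h1 N _)) _; first by rewrite /N; lia.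
  have : 0 <= c * d by rewrite mulr_ge0 // ltW.
  by rewrite mul1r -dE; lra.
pose w n := a n * (cutoff N (n + 1) - cutoff N n).
have comm n : jac a b f n - jac a b phi n =
    ((jac a b f n - (cutoff N n)%:C%C * jac a b f n) - (w n)%:C%C * f (n + 1))
    + (w (n - 1))%:C%C * f (n - 1).
  rewrite /jac /phi /w subrK.
  by apply: complex_eqP; rewrite !complexReIm; ring.
have wr n : nsq ((w n)%:C%C * f (n + 1)) <= c * nsq (tail N.-1 f (n + 1)).
  have := cutoff_commutator n aK N0; rewrite -/(w n) => wn.
  rewrite /tail; move: wn; case: ifPn => wn.
    rewrite normr_le0 => /eqP ->; rewrite mul0r nsq0.
    by rewrite mulr_ge0 ?nsq_ge0.
  rewrite ifF; last by move: wn; rewrite /win /N; lia.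
  by move/nsq_le_real => /(_ (f (n + 1))); rewrite /c exprMn;
    congr (_ <= _ * _ * _); ring.
have wl n : nsq ((w (n - 1))%:C%C * f (n - 1)) <= c * nsq (tail N f (n - 1)).
  have := cutoff_commutator (n - 1) aK N0; rewrite -/(w (n - 1)) => wn.
  rewrite /tail; move: wn; case: ifPn => wn.
    by rewrite normr_le0 => /eqP ->; rewrite mul0r nsq0 mulr0.
  by move/nsq_le_real => /(_ (f (n - 1))); rewrite /c exprMn;
    congr (_ <= _ * _ * _); ring.
have s1 : sqle (fun n => jac a b f n - (cutoff N n)%:C%C * jac a b f n) (1 * d).
  by apply: (sqle_dom ler01 (near_f _) (h2 N _)); rewrite /N; lia.
have s2 : sqle (fun n => (w n)%:C%C * f (n + 1)) (c * d).
  apply: (sqle_dom c0 wr); apply: sqle_succ; apply: h1; rewrite /N; lia.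
have s3 : sqle (fun n => (w (n - 1))%:C%C * f (n - 1)) (c * d).
  apply: (sqle_dom c0 wl); apply: sqle_pred; apply: h1; rewrite /N; lia.
apply: (eq_sqle comm); apply: sqle_trans (sqleD (sqleB s1 s2) s3) _.
by rewrite -dE; lra.
Qed.

End Cutoff.

(** * Closure and adjoint *)

Section Adjoint.
Context {R : realType}.
Implicit Types (a b : int -> R) (f g u v : zfun R) (lam : R[i]) (C K e : R).

Definition max_operator (L : zfun R -> zfun R) : operator R :=
  [set p | [/\ l2 p.1, l2 p.2 & p.2 = L p.1]].

Lemma nsq_jac_le a b u C n : (forall k, nsq (u k) <= C) ->
  nsq (jac a b u n) <=
    (4 * (a n) ^+ 2 + 4 * (b n) ^+ 2 + 2 * (a (n - 1)) ^+ 2) * C.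
Proof.
move=> uC; rewrite /jac.
have term (r : R) k : nsq (r%:C%C * u k) <= r ^+ 2 * C.
  by rewrite nsqM nsqC ler_wpM2l ?sqr_ge0.
apply: le_trans (nsqD_le _ _) _.
have := nsqD_le ((a n)%:C%C * u (n + 1)) (- ((b n)%:C%C * u n)).
rewrite nsqN.
have := term (a n) (n + 1); have := term (b n) n.
by have := term (a (n - 1)) (n - 1); lra.
Qed.

Lemma eq0_small (r c : R) : 0 <= r ->
  (forall e, 0 < e -> r <= c * e ^+ 2) -> r = 0.
Proof.
move=> r0 h; apply/eqP; rewrite eq_le r0 andbT leNgt; apply/negP => rpos.
have c1 : 0 < 2 * (`|c| + 1) by have := normr_ge0 c; lra.
have [d d0 dE] : exists2 d : R, 0 < d & 2 * (`|c| + 1) * d = r.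
  exists (r / (2 * (`|c| + 1))); first by rewrite divr_gt0.
  by rewrite mulrC divfK // gt_eqF.
have := h (Num.sqrt d); rewrite sqrtr_gt0 => /(_ d0); rewrite sqr_sqrtr; last exact: ltW.
have : c * d <= `|c| * d by rewrite ler_wpM2r ?ler_norm // ltW.
have : 0 <= `|c| * d by rewrite mulr_ge0 // ltW.
by lra.
Qed.

(** A limit in the graph norm is a pointwise limit, and [jac] is local, so the
    closure acts by the same expression; conversely [jac_approx] reaches the
    whole maximal domain. *)
Lemma closure_jac a b K : linear_growth a K ->
  op_closure (minimal_operator (jac a b)) = max_operator (jac a b).
Proof.
move=> aK; apply/seteqP; split=> -[f g] [/= lf lg h]; split=> //=.
  apply/funext => n; apply/eqP; rewrite -subr_eq0; apply/eqP/nsq_eq0.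
  pose c := 2 + 2 * (4 * (a n) ^+ 2 + 4 * (b n) ^+ 2 + 2 * (a (n - 1)) ^+ 2).
  apply: (@eq0_small _ c) => [|e e0]; first exact: nsq_ge0.
  have [[phi psi] /= [phi0 /= ->] [/l2norm_lt_sqle s1 /l2norm_lt_sqle s2]] := h e e0.
  have -> : g n - jac a b f n =
      (g n - jac a b phi n) - jac a b (fun n => f n - phi n) n.
    by rewrite jacB; ring.
  apply: le_trans (nsqD_le _ _) _; rewrite nsqN.
  have := sqle_term n s2; have := nsq_jac_le a b n (fun k => sqle_term k s1).
  by rewrite /c; lra.
move=> e e0; move/l2P: lf => [C1 fC1]; move/l2P: lg => [C2]; rewrite h => fC2.
have d0 : 0 < (e / 2) ^+ 2 by rewrite exprn_gt0 // divr_gt0.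
have [phi phi0 [s1 s2]] := jac_approx aK fC1 fC2 d0.
by exists (phi, jac a b phi) => //=; split; exact: sqle_l2norm_lt.
Qed.

Lemma Re_wsum N (F : int -> R[i]) :
  complex.Re (wsum N F) = wsum N (fun n => complex.Re (F n)).
Proof.
elim: N => [|N IH]; first by rewrite /wsum !big_ord0.
by rewrite !wsumS !complexReD IH.
Qed.

Lemma Im_wsum N (F : int -> R[i]) :
  complex.Im (wsum N F) = wsum N (fun n => complex.Im (F n)).
Proof.
elim: N => [|N IH]; first by rewrite /wsum !big_ord0.
by rewrite !wsumS !complexImD IH.
Qed.

Lemma ler_norm_wsum N (F G : int -> R) : (forall n, `|F n| <= G n) ->
  `|wsum N F| <= wsum N G.
Proof.
move=> FG; apply: le_trans (ler_norm_sum _ _ _) _; apply: ler_sum => k _.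
by apply: le_trans (ler_normD _ _) _; rewrite lerD.
Qed.

(** A Cauchy-Schwarz estimate, in the additive form
    [|x y| <= x^2 / (2 t) + t y^2 / 2] with [t] chosen small with respect to
    the bound [C] of [v]. *)
Lemma wsum_inner_small v C e : sqle v C -> 0 < e ->
  exists2 d, 0 < d & forall u, sqle u d ->
    forall N, nsq (wsum N (fun n => u n * (v n)^*)) <= e.
Proof.
move=> vC e0; have C0 := sqle_ge0 vC.
have [c [c0 c1 ce]] : exists c : R, [/\ 0 < c, c <= 1 & 2 * c <= e].
  exists (Num.min 1 (e / 2)); split; first by rewrite lt_min ltr01 divr_gt0.
    by rewrite ge_min lexx.
  have : Num.min 1 (e / 2) <= e / 2 by rewrite ge_min lexx orbT.
  by lra.
have [t t0 tC] : exists2 t : R, 0 < t & (C + 1) * t = c.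
  by exists (c / (C + 1)); [rewrite divr_gt0 //|rewrite mulrC divfK //]; lra.
exists (c * t); first by rewrite mulr_gt0.
move=> u ud N.
pose G n := (2 * t)^-1 * nsq (u n) + t / 2 * nsq (v n).
have Gc : wsum N G <= c.
  rewrite wsumD !wsumZ.
  have : (2 * t)^-1 * wsum N (fun n => nsq (u n)) <= c / 2.
    rewrite mulrC ler_pdivrMr ?mulr_gt0 //.
    by have := ud N; rewrite /comp; nra.
  have : t / 2 * wsum N (fun n => nsq (v n)) <= t / 2 * C.
    by rewrite ler_wpM2l ?(vC N) // divr_ge0 // ltW.
  by nra.
have bnd (p q r s : R) : `|p * q + r * s| <=
    (2 * t)^-1 * (p ^+ 2 + r ^+ 2) + t / 2 * (q ^+ 2 + s ^+ 2).
  have am x y : `|x * y| <= (2 * t)^-1 * x ^+ 2 + t / 2 * y ^+ 2.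
    have -> : (2 * t)^-1 * x ^+ 2 + t / 2 * y ^+ 2 =
        (x ^+ 2 + t ^+ 2 * y ^+ 2) / (2 * t) by field; lra.
    rewrite ler_pdivlMr ?mulr_gt0 // normrM -(real_normK (num_real x)).
    rewrite -(real_normK (num_real y)).
    by have := sqr_ge0 (`|x| - t * `|y|); nra.
  apply: le_trans (ler_normD _ _) _.
  by have := am p q; have := am r s; lra.
have small x : `|complex.Re x| <= c -> `|complex.Im x| <= c -> nsq x <= e.
  rewrite /nsq -(real_normK (num_real (complex.Re x))).
  rewrite -(real_normK (num_real (complex.Im x))).
  by move: (normr_ge0 (complex.Re x)) (normr_ge0 (complex.Im x)); nra.
apply: small; [rewrite Re_wsum|rewrite Im_wsum];
  apply: (le_trans (@ler_norm_wsum N _ G _)) => // n; rewrite !complexReIm /G /nsq.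
- by rewrite mulrN opprK; exact: bnd.
- rewrite mulrN addrC -mulrN.
  have := bnd (complex.Im (u n)) (complex.Re (v n))
    (complex.Re (u n)) (- complex.Im (v n)).
  by rewrite sqrrN; lra.
Qed.

(** Both sequences have the same limits, and [lim] is a choice among them; so
    series of inner products can be compared without discussing their
    convergence. *)
Lemma lim_eq_sub0 (K : numFieldType) (V : normedModType K) (s1 s2 : nat -> V) :
  (s1 - s2) @ \oo --> (0 : V) -> limn s1 = limn s2.
Proof.
move=> d0; suff E : [set l : V | s1 @ \oo --> l] = [set l : V | s2 @ \oo --> l].
  exact: (congr1 (xget (point : V)) E).
apply/funext => l; apply/propext; split => hl.
  have -> : s2 = s1 - (s1 - s2) by rewrite opprB addrC subrK.
  by rewrite -[l]subr0; apply: cvgB.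
have -> : s1 = (s1 - s2) + s2 by rewrite subrK.
by rewrite -[l]add0r; apply: cvgD.
Qed.

Lemma l2inner_eq f1 g1 f2 g2 :
  (forall e, 0 < e -> exists M, forall N, (M <= N)%N ->
    nsq (wsum N (fun n => f1 n * (g1 n)^* - f2 n * (g2 n)^*)) <= e) ->
  l2inner f1 g1 = l2inner f2 g2.
Proof.
move=> h.
pose s1 : nat -> R[i]^o := fun N => wsum N (fun n => f1 n * (g1 n)^*).
pose s2 : nat -> R[i]^o := fun N => wsum N (fun n => f2 n * (g2 n)^*).
have d0 : (s1 - s2) @ \oo --> (0 : R[i]^o).
  apply/cvgr0Pnorm_lt => e e0.
  have [eR e0'] : e = (complex.Re e)%:C%C /\ 0 < complex.Re e.
    move: e0; rewrite ltcE /= => /andP[/eqP Ie Re]; split=> //.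
    exact: complex_eqP.
  have [M hM] := h ((complex.Re e / 2) ^+ 2) (exprn_gt0 _ (divr_gt0 e0' (ltr0Sn _ _))).
  exists M => // N /= /hM; rewrite wsumB => sN.
  rewrite eR normc_def ltcR.
  apply: (le_lt_trans (ler_wsqrtr sN)).
  by rewrite sqrtr_sqr ger0_norm; lra.
exact: lim_eq_sub0 d0.
Qed.

End Adjoint.

Section SelfAdjoint.
Context {R : realType}.
Implicit Types (a b : int -> R) (f g h u v : zfun R) (lam : R[i]) (C K e : R).

Definition delta (m : int) : zfun R := fun n => (n == m)%:R.

Lemma delta_l2_0 m : l2_0 (delta m).
Proof.
apply/l2_0P; exists `|m|.+1 => n nm; rewrite /delta; case: eqP => // nE.
by move: nm; rewrite nE win_absz.
Qed.

Lemma wsum_delta m h N : win N m ->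
  wsum N (fun n => delta m n * (h n)^*) = (h m)^*.
Proof.
elim: N => [|N IH]; first by rewrite /win; lia.
rewrite wsumS /delta => wm; have [wN|wN] := boolP (win N m).
  rewrite IH //; have -> : (N%:Z == m) = false by move: wN; rewrite /win; lia.
  have -> : (Negz N == m) = false by move: wN; rewrite /win; lia.
  by rewrite !mul0r !addr0.
have -> : wsum N (fun n : int => (n == m)%:R * (h n)^*) = 0.
  rewrite -(mul0r (wsum N (fun=> 0))) -wsumZ; apply: eq_wsum_win => n wn.
  have -> : (n == m) = false by apply/eqP => nE; move: wN; rewrite -nE wn.
  by rewrite !mul0r.
have [<-|mN] := eqVneq (Posz N) m.
  by have -> : (Negz N == N) = false by []; rewrite mul1r mul0r addr0 add0r.
have -> : m = Negz N by move: wm wN mN; rewrite /win; lia.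
by rewrite eqxx mul1r mul0r !add0r.
Qed.

Lemma l2inner_delta m h : l2inner (delta m) h = (h m)^*.
Proof.
apply: (@lim_near_cst (R[i]^o)) => //.
exists `|m|.+1 => // N /= mN.
by apply: wsum_delta; move: mN; rewrite /win; lia.
Qed.

Lemma l2inner_jac_l2_0 a b f g : l2_0 f ->
  l2inner (jac a b f) g = l2inner f (jac a b g).
Proof.
move=> /l2_0P[M fM]; apply: l2inner_eq => e e0; exists M.+2 => N MN.
by rewrite green0 ?nsq0 ?(ltW e0) //; apply: fM; rewrite /win; lia.
Qed.

(** Approximating [f] by a finitely supported [phi] in the graph norm, the
    difference of the partial sums for [phi] is eventually 0 by
    [green0], and the remainder is uniformly small by [wsum_inner_small]. *)
Lemma l2inner_jac a b K f g : linear_growth a K ->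
  l2 f -> l2 (jac a b f) -> l2 g -> l2 (jac a b g) ->
  l2inner (jac a b f) g = l2inner f (jac a b g).
Proof.
move=> aK /l2P[C1 s1] /l2P[C2 s2] /l2P[C3 s3] /l2P[C4 s4].
apply: l2inner_eq => e e0; have e4 : 0 < e / 4 by rewrite divr_gt0.
have [d1 d10 h1] := wsum_inner_small s3 e4.
have [d2 d20 h2] := wsum_inner_small s4 e4.
have d0 : 0 < Num.min d1 d2 by rewrite lt_min d10.
have [phi phi0 [t1 t2]] := jac_approx aK s1 s2 d0.
have [M phiM] := (l2_0P _).1 phi0.
exists M.+2 => N MN.
have E0 := @green0 _ a b phi g N.
rewrite -[wsum _ _]subr0 -E0; try by apply: phiM; rewrite /win; lia.
rewrite -wsumB.
rewrite (@eq_wsum _ _ _ (fun n => (jac a b f n - jac a b phi n) * (g n)^*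
   - (f n - phi n) * (jac a b g n)^*)); last by move=> n; ring.
rewrite wsumB; apply: le_trans (nsqD_le _ _) _; rewrite nsqN.
have := h1 _ (sqle_trans t2 _) N; rewrite ge_min lexx => /(_ isT).
have := h2 _ (sqle_trans t1 _) N; rewrite ge_min lexx orbT => /(_ isT).
by lra.
Qed.

Lemma max_operator_l2_0 a b f : l2_0 f -> max_operator (jac a b) (f, jac a b f).
Proof.
by move=> f0; split=> //=; apply/l2P/l2_0_sqle; last exact: l2_0_jac.
Qed.

(** Testing against the sequences [delta m] shows that an element of the adjoint
    graph satisfies the difference equation at [m]. *)
Lemma adjoint_jac a b K : linear_growth a K ->
  adjoint (max_operator (jac a b)) = max_operator (jac a b).
Proof.
move=> aK; apply/seteqP; split=> -[f g] [/= lf lg h]; split=> //=.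
  apply/funext => m; have := h _ (max_operator_l2_0 a b (delta_l2_0 m)) => /=.
  rewrite (l2inner_jac_l2_0 _ _ _ (delta_l2_0 m)) !l2inner_delta.
  by move=> /(inv_inj conjCK).
by move=> [u v] [/= lu lv vE]; subst g v; exact: (l2inner_jac aK).
Qed.

Lemma selfadjoint_jac a b K : linear_growth a K ->
  selfadjoint (op_closure (minimal_operator (jac a b))).
Proof.
move=> aK; rewrite (closure_jac b aK) /selfadjoint (adjoint_jac b aK).
split=> // g /l2P[C gC] e e0.
have e2 : 0 < (e / 2) ^+ 2 by rewrite exprn_gt0 // divr_gt0.
have [M hM] := tail_sqle gC e2.
exists (fun n => g n - tail M g n).
  exists (jac a b (fun n => g n - tail M g n)); apply: max_operator_l2_0.
  by apply/l2_0P; exists M => n nM; rewrite /tail (negbTE nM) subrr.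
apply: sqle_l2norm_lt => //; apply: eq_sqle (hM M (leqnn _)) => n.
by rewrite opprB addrCA subrr addr0.
Qed.

End SelfAdjoint.

(** * Surjectivity of the resolvent equation *)

Section Resolvent.
Context {R : realType}.
Implicit Types (a b : int -> R) (f g h u v : zfun R) (lam : R[i]) (C K e : R).

Definition extend N (w : 'rV[R[i]]_(N + N)) : zfun R := fun n =>
  \sum_j w 0 j * delta (j%:Z - N%:Z) n.

Definition trunc_mx a b lam N : 'M[R[i]]_(N + N) := \matrix_(j, i)
  (jac a b (delta (j%:Z - N%:Z)) (i%:Z - N%:Z)
   - lam * delta (j%:Z - N%:Z) (i%:Z - N%:Z)).

Lemma extend_out N w n : ~~ win N n -> @extend N w n = 0.
Proof.
move=> nN; apply: big1 => j _; rewrite /delta.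
have -> : (n == j%:Z - N%:Z) = false.
  by move: nN (ltn_ord j); rewrite /win; lia.
by rewrite mulr0.
Qed.

Lemma extend_in N w (j : 'I_(N + N)) : @extend N w (j%:Z - N%:Z) = w 0 j.
Proof.
rewrite /extend (bigD1 j) //= /delta eqxx mulr1 big1 ?addr0 // => i ij.
have -> : (j%:Z - N%:Z == i%:Z - N%:Z) = false.
  by apply: contraNF ij => /eqP ij; apply/eqP/val_inj => /=; lia.
by rewrite mulr0.
Qed.

Lemma trunc_mxE a b lam N (w : 'rV_(N + N)) i :
  (w *m trunc_mx a b lam N) 0 i =
    jac a b (extend w) (i%:Z - N%:Z) - lam * extend w (i%:Z - N%:Z).
Proof.
rewrite !mxE /jac /extend !mulr_sumr -sumrB -big_split /= -sumrB.
by apply: eq_bigr => j _; rewrite !mxE /jac; ring.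
Qed.

Lemma win_ordP N n : win N n -> exists j : 'I_(N + N), n = j%:Z - N%:Z.
Proof.
rewrite /win => wn; have lt_n : (`|(n + N%:Z)%R| < N + N)%N by lia.
by exists (Ordinal lt_n) => /=; lia.
Qed.

(** The compression of [J - lam] to a window is injective by
    [resolvent_window], hence invertible. *)
Lemma trunc_solve a b lam N g : complex.Im lam != 0 ->
  exists v, (forall n, ~~ win N n -> v n = 0) /\
    (forall n, win N n -> jac a b v n - lam * v n = g n).
Proof.
move=> mu0; have unitA : trunc_mx a b lam N \in unitmx.
  rewrite -row_free_unit; apply: inj_row_free => w wA0.
  pose v := extend w.
  have v0 n : ~~ win N n -> v n = 0 by exact: extend_out.
  have eq0 n : win N n -> jac a b v n - lam * v n = 0.
    by move=> /win_ordP[j ->]; rewrite -trunc_mxE wA0 mxE.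
  have : complex.Im lam ^+ 2 * wsum N (nsq \o v) <= 0.
    have v1 : v N%:Z = 0 by apply: v0; rewrite /win; lia.
    have v2 : v (- N%:Z - 1) = 0 by apply: v0; rewrite /win; lia.
    apply: (le_trans (resolvent_window a b lam v1 v2)).
    rewrite -(mul0r (wsum N (fun=> 0))) -wsumZ le_eqVlt; apply/orP; left.
    by apply/eqP; apply: eq_wsum_win => n wn; rewrite eq0 // nsq0 mul0r.
  rewrite pmulr_rle0 ?exprn_even_gt0 // => sum0.
  apply/rowP => j; rewrite mxE -(extend_in w); apply: nsq_eq0; apply/eqP.
  rewrite eq_le nsq_ge0 andbT; apply: le_trans sum0.
  apply: (@wsum_ge_term _ _ (nsq \o v)) => [n|]; first exact: nsq_ge0.
  by move: (ltn_ord j); rewrite /win; lia.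
pose G := \row_(i < N + N) g (i%:Z - N%:Z).
exists (extend (G *m invmx (trunc_mx a b lam N))); split.
  by move=> n; exact: extend_out.
by move=> n /win_ordP[j ->]; rewrite -trunc_mxE mulmxKV // mxE.
Qed.

Lemma trunc_bound a b lam N g v C : complex.Im lam != 0 -> sqle g C ->
  (forall n, ~~ win N n -> v n = 0) ->
  (forall n, win N n -> jac a b v n - lam * v n = g n) ->
  sqle v (C / complex.Im lam ^+ 2).
Proof.
move=> mu0 gC v0 vE; apply: sqle_trans (sqle_supported v0) _.
rewrite ler_pdivlMr ?exprn_even_gt0 // mulrC; apply: (le_trans _ (gC N)).
have v1 : v N%:Z = 0 by apply: v0; rewrite /win; lia.
have v2 : v (- N%:Z - 1) = 0 by apply: v0; rewrite /win; lia.
apply: (le_trans (resolvent_window a b lam v1 v2)).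
rewrite le_eqVlt; apply/orP; left; apply/eqP.
by apply: eq_wsum_win => n wn; rewrite /= vE.
Qed.

Lemma ultra_cvg_bounded (U : set_system nat) (s : nat -> R) B :
  UltraFilter U -> (forall n, `|s n| <= B) -> exists l : R, s @ U --> l.
Proof.
move=> UU sB.
have PU : ProperFilter U := ultra_proper.
have sU : (s @ U) `[- B, B]%classic.
  apply: (@filterS _ U _ setT) => [n _|]; last exact: filterT.
  by rewrite /= in_itv /= -ler_norml.
have [l [_ cl]] := @segment_compact R (- B) B (s @ U) _ sU.
exists l => V Vl; have [//|notV] := in_ultra_setVsetC (s @^-1` V) UU.
by have [x [Vx]] := cl (~` V) V notV Vl.
Qed.

Section ComplexLimits.
Context (U : set_system nat) {PU : ProperFilter U}.
Implicit Types (x y : nat -> R[i]).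

Definition ccvg x (l : R[i]) :=
  (fun N => complex.Re (x N)) @ U --> complex.Re l /\
  (fun N => complex.Im (x N)) @ U --> complex.Im l.

Lemma ccvgD x y k l : ccvg x k -> ccvg y l ->
  ccvg (fun N => x N + y N) (k + l).
Proof.
move=> [xk1 xk2] [yl1 yl2]; rewrite /ccvg !complexReIm.
split; under eq_fun do rewrite !complexReIm; exact: cvgD.
Qed.

Lemma ccvgMl c x l : ccvg x l -> ccvg (fun N => c * x N) (c * l).
Proof.
move=> [xl1 xl2]; rewrite /ccvg !complexReIm.
split; under eq_fun do rewrite !complexReIm.
  by apply: cvgB; apply: cvgMr.
by apply: cvgD; apply: cvgMr.
Qed.

Lemma ccvgN x l : ccvg x l -> ccvg (fun N => - x N) (- l).
Proof.
move=> /(ccvgMl (-1)); rewrite mulN1r.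
by under eq_fun do rewrite mulN1r.
Qed.

Lemma ccvg_nsq x l : ccvg x l -> (fun N => nsq (x N)) @ U --> nsq l.
Proof. by move=> [xl1 xl2]; apply: cvgD; apply: cvgM. Qed.

Lemma ccvg_eq_near x k l : ccvg x l -> (\near U, x U = k) -> l = k.
Proof.
move=> [xl1 xl2] xk; apply: complex_eqP.
- rewrite -(cvg_lim _ xl1) //; apply: lim_near_cst => //.
  by apply: filterS xk => N ->.
- rewrite -(cvg_lim _ xl2) //; apply: lim_near_cst => //.
  by apply: filterS xk => N ->.
Qed.

Lemma ccvg_jac a b (v : nat -> zfun R) f lam n :
  (forall k, ccvg (fun N => v N k) (f k)) ->
  ccvg (fun N => jac a b (v N) n - lam * v N n) (jac a b f n - lam * f n).
Proof.
move=> vf; apply: ccvgD; last exact/ccvgN/ccvgMl.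
by apply: ccvgD; [apply: ccvgD; [|apply: ccvgN]|]; exact: ccvgMl.
Qed.

Lemma ccvg_sqle (v : nat -> zfun R) f B :
  (forall k, ccvg (fun N => v N k) (f k)) -> (forall N, sqle (v N) B) -> sqle f B.
Proof.
move=> vf vB k.
have h : (fun N => wsum k (nsq \o v N)) @ U --> wsum k (nsq \o f).
  elim: k => [|k IH].
    rewrite /wsum big_ord0; under eq_fun do rewrite big_ord0; exact: cvg_cst.
  rewrite wsumS; under eq_fun do rewrite wsumS.
  by apply: cvgD => //; apply: cvgD; exact: ccvg_nsq.
rewrite -(cvg_lim _ h) //; apply: limr_le; first by apply/cvg_ex; eexists; exact: h.
by apply: nearW => N; exact: vB.
Qed.

End ComplexLimits.

(** The solutions of the truncated equations have a common [l2] bound, so each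
    of their coordinates converges along an ultrafilter finer than the
    neighborhoods of infinity.  The equation at a given [n] involves three
    coordinates only and holds for all large windows, so it passes to the
    limit; the [l2] bound does because it is a bound on finite sums. *)
Lemma resolvent_exists a b lam g C : complex.Im lam != 0 -> sqle g C ->
  exists2 f, sqle f (C / complex.Im lam ^+ 2) &
    forall n, jac a b f n - lam * f n = g n.
Proof.
move=> mu0 gC; have [v hv] := choice (fun N => trunc_solve a b N g mu0).
set B := C / _.
have vB N : sqle (v N) B by exact: (trunc_bound mu0 gC (hv N).1 (hv N).2).
have [U [UU subU]] := ultraFilterLemma eventually_filter.
have PU : ProperFilter U := ultra_proper.
(* [B + 1] bounds a square root of [B]. *)
have le1 (p q : R) : p ^+ 2 + q ^+ 2 <= B -> `|p| <= B + 1.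
  rewrite -(real_normK (num_real p)); have := sqr_ge0 q.
  by move: (normr_ge0 p); nra.
have reB n N : `|complex.Re (v N n)| <= B + 1.
  by apply: le1; exact: (sqle_term n (vB N)).
have imB n N : `|complex.Im (v N n)| <= B + 1.
  by apply: (@le1 _ (complex.Re (v N n))); rewrite addrC; exact: (sqle_term n (vB N)).
have [fr hr] := choice (fun n => ultra_cvg_bounded UU (reB n)).
have [fi hi] := choice (fun n => ultra_cvg_bounded UU (imB n)).
pose f : zfun R := fun n => Complex (fr n) (fi n).
have vf n : ccvg U (fun N => v N n) (f n) by split; [exact: hr|exact: hi].
exists f; first exact: (ccvg_sqle vf vB).
move=> n; apply: (ccvg_eq_near (ccvg_jac a b lam n vf)).
apply: subU; exists `|n|.+1 => // N /= nN.
by apply: (hv N).2; move: nN; rewrite /win; lia.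
Qed.

End Resolvent.

(** * Strong resolvent convergence *)

Section StrongResolvent.
Context {R : realType}.
Implicit Types (a b : int -> R) (f g h u v phi : zfun R) (lam : R[i]) (C K e : R).

Lemma l2norm_cvg0 T (F : set_system T) (u : T -> zfun R) : Filter F ->
  (forall e, 0 < e -> \forall t \near F, sqle (u t) e) ->
  l2norm (u t) @[t --> F] --> (0 : \bar R).
Proof.
move=> FF small V /= [e /= e0 eV].
have e2 : 0 < (e / 2) ^+ 2 by rewrite exprn_gt0 // divr_gt0.
apply: filterS (small _ e2) => t /(sqle_l2norm_lt e0) ut; rewrite /= /nbhs /=.
have := l2norm_ge0 (u t); move: ut; case: (l2norm (u t)) => [r| |] // rlt r0.
by apply: eV; rewrite /ball /= sub0r normrN ger0_norm -?lee_fin -?lte_fin.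
Qed.

(** The bound [l2_0_resolvent] carried to the maximal domain by approximation;
    the factor 4 and the term [e] come from two uses of [nsqD_le]. *)
Lemma resolvent_bound a b K lam u C e : linear_growth a K ->
  complex.Im lam != 0 -> l2 u -> l2 (jac a b u) ->
  sqle (fun n => jac a b u n - lam * u n) C -> 0 < e ->
  sqle u (4 * C / complex.Im lam ^+ 2 + e).
Proof.
move=> aK mu0 /l2P[C1 s1] /l2P[C2 s2] uC e0.
have mu2 : 0 < complex.Im lam ^+ 2 by rewrite exprn_even_gt0.
pose L := nsq lam; have L0 : 0 <= L by exact: nsq_ge0.
pose c := 8 * (1 + L) / complex.Im lam ^+ 2 + 2.
have c0 : 0 < c.
  have : 0 <= 8 * (1 + L) / complex.Im lam ^+ 2.
    by rewrite divr_ge0 ?(ltW mu2) // mulr_ge0 // addr_ge0.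
  by rewrite /c; lra.
have [d d0 dE] : exists2 d : R, 0 < d & c * d = e.
  by exists (e / c); [rewrite divr_gt0|rewrite mulrC divfK // gt_eqF].
have [phi phi0 [t1 t2]] := jac_approx aK s1 s2 d0.
have t3 : sqle (fun n => jac a b phi n - lam * phi n)
    (2 * C + 2 * (2 * d + 2 * (L * d))).
  apply: eq_sqle (sqleB uC (sqleB t2 (sqleZ lam t1))) => n /=; ring.
have t4 := l2_0_resolvent mu0 phi0 t3.
apply: (@sqle_trans _ _ _ _ _); first apply: eq_sqle (sqleD t4 t1) => n.
  by rewrite addrC subrK.
by rewrite -dE /c le_eqVlt; apply/orP; left; apply/eqP; field.
Qed.

(** [op_app] is the null sequence outside the domain of an operator;
    [resolvent_exists] rules this case out. *)
Lemma op_app_resolvent a b K lam g (f := op_app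
    (resolvent (op_closure (minimal_operator (jac a b))) lam) g) :
  linear_growth a K -> complex.Im lam != 0 -> l2 g ->
  [/\ l2 f, l2 (jac a b f) & forall n, jac a b f n - lam * f n = g n].
Proof.
move=> aK mu0 /l2P[C gC]; rewrite /f (closure_jac b aK) /op_app.
set S := (X in xget _ X).
suff /(@xgetPex _ (fun=> 0)) : exists x, S x.
  move: (xget _ S) => x [y [/= lx ly yE] gE]; split=> // [|n].
    by rewrite -yE.
  by rewrite -yE [in RHS]gE.
have [x xC xE] := resolvent_exists a b mu0 gC.
have jE : jac a b x = fun n => g n + lam * x n.
  by apply/funext => n; rewrite -xE subrK.
exists x; exists (jac a b x) => /=; last by apply/funext => n; rewrite xE.
split=> //=; apply/l2P; first by exists (C / complex.Im lam ^+ 2).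
rewrite jE; eexists; exact: sqleD gC (sqleZ lam xC).
Qed.

(** Only finitely many coefficients are seen by [phi], so their pointwise
    convergence suffices. *)
Lemma jac_perturbation T (F : set_system T) (a_ b_ : T -> int -> R) a b phi e :
  Filter F ->
  (forall n, a_ t n @[t --> F] --> a n) -> (forall n, b_ t n @[t --> F] --> b n) ->
  l2_0 phi -> 0 < e ->
  \forall t \near F,
    sqle (fun n => jac a b phi n - jac (a_ t) (b_ t) phi n) e.
Proof.
move=> FF acvg bcvg phi0 e0; have [C phiC] := l2_0_sqle phi0.
have [M phiM] := (l2_0P phi).1 phi0.
pose G t n := (4 * (a n - a_ t n) ^+ 2 + 4 * (b n - b_ t n) ^+ 2
   + 2 * (a (n - 1) - a_ t (n - 1)) ^+ 2) * C.
have G0 N : wsum N (G t) @[t --> F] --> 0.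
  have sq0 c (c_ : T -> int -> R) n : c_ t n @[t --> F] --> c n ->
      (c n - c_ t n) ^+ 2 @[t --> F] --> 0.
    move=> cc.
    have : c n - c_ t n @[t --> F] --> c n - c n.
      by apply: cvgB => //; exact: cvg_cst.
    rewrite subrr => d0; rewrite -(mulr0 (0 : R)).
    by under eq_fun do rewrite expr2; exact: cvgM.
  have Gn n : G t n @[t --> F] --> 0.
    have -> : (0 : R) = (4 * 0 + 4 * 0 + 2 * 0) * C by rewrite !mulr0 !addr0 mul0r.
    apply: cvgM; last exact: cvg_cst.
    by apply: cvgD; [apply: cvgD|]; apply: cvgMr; apply: sq0.
  elim: N => [|N IH].
    by rewrite /wsum; under eq_fun do rewrite big_ord0; exact: cvg_cst.
  under eq_fun do rewrite wsumS; rewrite -(addr0 (0 : R)); apply: cvgD => //.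
  by rewrite -(addr0 (0 : R)); exact: cvgD.
apply: filterS (cvgr_lt _ (G0 M.+1) _ e0) => t Gt.
have supp n : ~~ win M.+1 n -> jac a b phi n - jac (a_ t) (b_ t) phi n = 0.
  move=> nM; rewrite /jac !phiM ?(mulr0, subr0, addr0, subrr) //;
    by move: nM; rewrite /win; lia.
apply: sqle_trans (sqle_supported supp) _; apply: (le_trans _ (ltW Gt)).
apply: ler_wsum => n /=.
have -> : jac a b phi n - jac (a_ t) (b_ t) phi n =
    jac (fun n => a n - a_ t n) (fun n => b n - b_ t n) phi n.
  by rewrite /jac; apply: complex_eqP; rewrite !complexReIm; ring.
by apply: nsq_jac_le => k; exact: sqle_term.
Qed.

(** Finitely supported sequences are a common core: on them [J_t] converges to
    [J], and the resolvents of [J_t] are bounded uniformly in [t]. *)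
Lemma strong_resolvent_jac T (F : set_system T) (a_ b_ : T -> int -> R) a b K :
  Filter F -> linear_growth a K ->
  (\forall t \near F, exists K', linear_growth (a_ t) K') ->
  (forall n, a_ t n @[t --> F] --> a n) -> (forall n, b_ t n @[t --> F] --> b n) ->
  strong_resolvent_cvg F
    (fun t => op_closure (minimal_operator (jac (a_ t) (b_ t))))
    (op_closure (minimal_operator (jac a b))).
Proof.
move=> FF aK aK_ acvg bcvg lam lam_nreal g lg; apply: l2norm_cvg0 => e e0.
have mu0 : complex.Im lam != 0.
  by move: lam_nreal; case: (lam) => p q; rewrite complex_real.
have mu2 : 0 < complex.Im lam ^+ 2 by rewrite exprn_even_gt0.
set f := op_app (resolvent (op_closure (minimal_operator (jac a b))) lam) g.
have [/l2P[C1 s1] /l2P[C2 s2] fE] := op_app_resolvent b aK mu0 lg.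
rewrite -/f in s1 s2 fE.
pose L := nsq lam; have L0 : 0 <= L by exact: nsq_ge0.
(* The residual of [phi] in the equation for [J_t] is at most
   [(6 + 4 * L) * d]; [resolvent_bound] and the distance of [phi] to [f] turn
   this into [c * d]. *)
pose c := 8 * (6 + 4 * L) / complex.Im lam ^+ 2 + 4.
have c0 : 0 < c.
  have : 0 <= 8 * (6 + 4 * L) / complex.Im lam ^+ 2.
    by rewrite divr_ge0 ?(ltW mu2) // mulr_ge0 // addr_ge0 // mulr_ge0.
  by rewrite /c; lra.
have [d d0 dE] : exists2 d : R, 0 < d & c * d = e.
  by exists (e / c); [rewrite divr_gt0|rewrite mulrC divfK // gt_eqF].
have [phi phi0 [t1 t2]] := jac_approx aK s1 s2 d0.
apply: filterS2 aK_ (jac_perturbation FF acvg bcvg phi0 d0) => t [K' aK'] t3.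
have [lft ljft ftE] := op_app_resolvent (b_ t) aK' mu0 lg.
set ft := op_app _ g in lft ljft ftE *.
have [D1 p1] := l2_0_sqle phi0.
have [D2 p2] := l2_0_sqle (l2_0_jac (a_ t) (b_ t) phi0).
have ljE n : jac (a_ t) (b_ t) (fun n => ft n - phi n) n =
    jac (a_ t) (b_ t) ft n - jac (a_ t) (b_ t) phi n by exact: jacB.
have lu : l2 (fun n => ft n - phi n).
  by move/l2P: lft => [D3 p3]; apply/l2P; eexists; exact: sqleB p3 p1.
have lju : l2 (jac (a_ t) (b_ t) (fun n => ft n - phi n)).
  by move/l2P: ljft => [D3 p3]; apply/l2P; eexists; apply: eq_sqle ljE (sqleB p3 p2).
have res : sqle (fun n => jac (a_ t) (b_ t) (fun n => ft n - phi n) n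
    - lam * (ft n - phi n)) (2 * (2 * d + 2 * (L * d)) + 2 * d).
  apply: eq_sqle (sqleD (sqleB t2 (sqleZ lam t1)) t3) => n /=.
  have -> : jac (a_ t) (b_ t) (fun n => ft n - phi n) n =
      (jac a b f n - lam * f n) + lam * ft n - jac (a_ t) (b_ t) phi n.
    by rewrite ljE fE -(ftE n) subrK.
  by ring.
have ub := resolvent_bound aK' mu0 lu lju res d0.
apply: sqle_trans.
  by apply: eq_sqle (sqleB ub t1) => n; rewrite opprB addrC addrA subrK addrC.
by rewrite -dE /c le_eqVlt; apply/orP; left; apply/eqP; field.
Qed.

End StrongResolvent.

(** * The two difference operators *)

Section Coefficients.
Context {R : realType}.
Implicit Types (z w : R[i]) (xi K : R) (p : int -> R).

Lemma series_sum z w : principal_series z w \/ complementary_series z w ->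
  exists s : R, z + w = s%:C%C.
Proof.
case=> [[-> _]|[/RRe_real <- /RRe_real <- _]]; last by rewrite -rmorphD; eexists.
exists (complex.Re z *+ 2); case: z => x y.
by apply: complex_eqP => /=; rewrite ?subrr.
Qed.

(** In the principal series the product is [|z + n|^2]; in the complementary
    series no integer separates [- z] from [- w], so both factors have the same
    sign. *)
Lemma series_radicand z w :
  principal_series z w \/ complementary_series z w ->
  exists p, forall n, 0 <= p n /\ (z + n%:~R) * (w + n%:~R) = (p n)%:C%C.
Proof.
have intC (n : int) : n%:~R = (n%:~R : R)%:C%C :> R[i] by rewrite rmorph_int.
case=> [[-> _]|[/RRe_real <- /RRe_real <- [m]]].
  exists (fun n => (complex.Re z + n%:~R) ^+ 2 + complex.Im z ^+ 2) => n.
  split; first by rewrite addr_ge0 ?sqr_ge0.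
  by rewrite intC; case: z => x y; apply: complex_eqP => /=; ring.
move: (complex.Re z) (complex.Re w) => x y.
rewrite !intC !ltcR => /andP[/andP[x1 x2] /andP[y1 y2]].
exists (fun n => (x + n%:~R) * (y + n%:~R)) => n; split; last first.
  by rewrite intC rmorphM !rmorphD.
have [mn|mn] := leP 0 (m + n).
  have : 0 <= (m + n)%:~R :> R by rewrite ler0z.
  by rewrite intrD => ?; apply: mulr_ge0; lra.
have : (m + 1 + n)%:~R <= 0 :> R by rewrite lerz0; lia.
by rewrite intrD => ?; apply: mulr_le0; lra.
Qed.

Lemma radicand_growth z w p :
  (forall n, 0 <= p n /\ (z + n%:~R) * (w + n%:~R) = (p n)%:C%C) ->
  exists2 K, 0 <= K & forall n, p n <= (K * (`|n|%N%:R + 1)) ^+ 2.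
Proof.
move=> pE.
pose K := 1 + `|complex.Re z| + `|complex.Im z| + `|complex.Re w| + `|complex.Im w|.
have K0 : 0 <= K by rewrite /K !addr_ge0.
exists K => // n.
have intC : n%:~R = (n%:~R : R)%:C%C :> R[i] by rewrite rmorph_int.
have -> : p n = (complex.Re z + n%:~R) * (complex.Re w + n%:~R)
    - complex.Im z * complex.Im w.
  rewrite -[LHS](complexReC (p n)) -(pE n).2 intC.
  by rewrite !complexReIm; ring.
have bound (x y : R) : `|x| <= y -> forall x' y', `|x'| <= y' -> x * x' <= y * y'.
  move=> xy x' y' xy'; apply: le_trans (ler_norm _) _.
  by rewrite normrM ler_pM.
set k : R := `|n|%N%:R; have k0 : 0 <= k by rewrite /k.
have nE : `|n%:~R| = k by rewrite /k -intr_norm -abszE.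
have tri (x : R) : `|x + n%:~R| <= `|x| + k by rewrite -nE ler_normD.
have := bound _ _ (tri (complex.Re z)) _ _ (tri (complex.Re w)).
have := bound (- complex.Im z) `|complex.Im z| _ (complex.Im w) `|complex.Im w| (lexx _).
rewrite normrN => /(_ (lexx _)).
rewrite /K; move: (normr_ge0 (complex.Re z)) (normr_ge0 (complex.Im z))
  (normr_ge0 (complex.Re w)) (normr_ge0 (complex.Im w)).
move: `|complex.Re z| `|complex.Im z| `|complex.Re w| `|complex.Im w|.
move=> x1 x2 y1 y2 x10 x20 y10 y20 h1 h2.
have h3 : x1 + x2 + k <= (1 + x1 + x2 + y1 + y2) * (k + 1).
  have := mulr_ge0 x10 k0; have := mulr_ge0 x20 k0.
  by have := mulr_ge0 y10 k0; have := mulr_ge0 y20 k0; lra.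
have h4 : y1 + y2 + k <= (1 + x1 + x2 + y1 + y2) * (k + 1).
  have := mulr_ge0 x10 k0; have := mulr_ge0 x20 k0.
  by have := mulr_ge0 y10 k0; have := mulr_ge0 y20 k0; lra.
rewrite expr2; apply: (@le_trans _ _ ((x1 + x2 + k) * (y1 + y2 + k))).
  by nra.
by apply: ler_pM => //; rewrite !addr_ge0.
Qed.

Definition offdiag p xi (n : int) : R := Num.sqrt (xi * p (n + 1)).

Definition diag (s xi : R) (n : int) : R :=
  (n%:~R + 2^-1) + xi * (s + (n%:~R + 2^-1)).

Lemma offdiag_growth p K xi : 0 <= K -> 0 <= xi <= 1 -> (forall n, 0 <= p n) ->
  (forall n, p n <= (K * (`|n|%N%:R + 1)) ^+ 2) ->
  linear_growth (offdiag p xi) (2 * K).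
Proof.
move=> K0 /andP[xi0 xi1] p0 pK n.
rewrite /offdiag ger0_norm ?sqrtr_ge0 //.
have k0 (m : int) : 0 <= K * (`|m|%N%:R + 1) by rewrite mulr_ge0 // addr_ge0.
apply: (@le_trans _ _ (K * (`|(n + 1)%R|%N%:R + 1))).
  rewrite -[leRHS]ger0_norm // -sqrtr_sqr ler_wsqrtr //.
  by apply: le_trans (pK _); rewrite ler_piMl.
rewrite [2 * K]mulrC -mulrA ler_wpM2l //.
have : (`|(n + 1)%R| + 1 <= 2 * (`|n| + 1))%N by lia.
by rewrite -(ler_nat R) natrM !natrD.
Qed.

Lemma sqrtC_real (r : R) : 0 <= r -> sqrtC (r%:C%C) = (Num.sqrt r)%:C%C.
Proof.
move=> r0; rewrite -[in LHS](sqr_sqrtr r0) rmorphXn sqrCK //.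
by rewrite lecR sqrtr_ge0.
Qed.

Lemma diff_op_jac z w p s xi :
  (forall n, 0 <= p n /\ (z + n%:~R) * (w + n%:~R) = (p n)%:C%C) ->
  z + w = s%:C%C -> 0 <= xi ->
  diff_op z w xi = jac (offdiag p xi) (diag s xi).
Proof.
move=> pE sE xi0; apply/funext => f; apply/funext => n.
have radE m : sqrtC (xi%:C%C * (z + m%:~R) * (w + m%:~R)) =
    (Num.sqrt (xi * p m))%:C%C.
  by rewrite -mulrA (pE m).2 -rmorphM sqrtC_real // mulr_ge0 // (pE m).1.
have half : (2^-1 : R[i]) + 2^-1 = 1 by rewrite -[2^-1]mul1r -splitr.
have up (x : R[i]) : x + half_integer R n + 2^-1 = x + (n + 1)%:~R.
  by rewrite /half_integer intrD -!addrA half.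
have down (x : R[i]) : x + half_integer R n - 2^-1 = x + n%:~R.
  by rewrite /half_integer addrA addrK.
rewrite /diff_op /jac /= !up !down !radE /offdiag subrK sE.
congr (_ - _ * _ + _).
rewrite /diag /half_integer.
have -> : (n%:~R : R[i]) = (n%:~R : R)%:C%C by rewrite rmorph_int.
have -> : (2^-1 : R[i]) = (2^-1 : R)%:C%C by rewrite fmorphV rmorph_nat.
by rewrite !(rmorphD, rmorphM).
Qed.

Lemma diff_op_gammaE z w : diff_op_gamma z w = diff_op z w 1.
Proof.
apply/funext => f; apply/funext => n.
rewrite /diff_op_gamma /diff_op /= !mul1r.
by congr (_ - _ * _ + _); ring.
Qed.

End Coefficients.

Theorem proposition5p3 (R : realType) (z z' : R[i])
    (hzz' : principal_series z z' \/ complementary_series z z') :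
  [/\ forall xi : R, 0 < xi < 1 -> selfadjoint (D z z' xi),
      selfadjoint (D_gamma z z') &
      strong_resolvent_cvg (1 : R)^'- (fun xi => D z z' xi) (D_gamma z z')].
Proof.
have [s sE] := series_sum hzz'; have [p pE] := series_radicand hzz'.
have [K K0 pK] := radicand_growth pE.
have p0 n : 0 <= p n := (pE n).1.
have growth xi : 0 <= xi <= 1 -> linear_growth (offdiag p xi) (2 * K).
  by move=> xi01; exact: offdiag_growth.
have DE xi : 0 <= xi -> D z z' xi =
    op_closure (minimal_operator (jac (offdiag p xi) (diag s xi))).
  by move=> xi0; rewrite /D (diff_op_jac pE sE xi0).
have DgE : D_gamma z z' =
    op_closure (minimal_operator (jac (offdiag p 1) (diag s 1))).
  by rewrite -DE ?ler01 // /D_gamma diff_op_gammaE.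
have growth1 := growth 1 _; rewrite ler01 lexx in growth1.
split=> [xi /andP[xi0 xi1]||].
- by rewrite DE ?ltW //; apply: selfadjoint_jac (growth xi _); rewrite !ltW.
- by rewrite DgE; exact: selfadjoint_jac (growth1 isT).
rewrite DgE.
have below1 : \forall xi \near (1 : R)^'-, 0 < xi < 1.
  near=> xi; apply/andP; split; near: xi; first exact: nbhs_left_gt.
  exact: nbhs_left_lt.
have cvg1 : xi @[xi --> (1 : R)^'-] --> (1 : R) by exact: cvg_at_left_filter.
have D' : strong_resolvent_cvg (1 : R)^'- (fun xi =>
    op_closure (minimal_operator (jac (offdiag p xi) (diag s xi))))
    (op_closure (minimal_operator (jac (offdiag p 1) (diag s 1)))).
  apply: (strong_resolvent_jac _ (growth1 isT)) => [|n|n].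
  - apply: filterS below1 => xi /andP[xi0 xi1]; exists (2 * K).
    by apply: growth; rewrite !ltW.
  - apply: cvg_comp; last exact: sqrt_continuous.
    by apply: cvgM => //; exact: cvg_cst.
  - by apply: cvgD; [exact: cvg_cst|apply: cvgM => //; exact: cvg_cst].
move=> lam lam_nreal g lg; apply: cvg_trans (D' lam lam_nreal g lg).
apply: near_eq_cvg; apply: filterS below1 => xi /andP[xi0 _].
by rewrite /= DE // ltW.
Unshelve. all: by end_near. Qed.
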